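(* Let $T$ be a linear operator generated by an endomorphism $\tau$ of $(\Omega,\beta,\mu)$ and let $S_nf=\frac1n\sum_{i=0}^{n-1}T^if$. Let $(F_n)$ be a decreasing sequence of $\sigma$-subalgebras of $\beta$ with $F_n\downarrow F_\infty$, and let $\sup_n\|S_nf\|_X\in L_1$. 1. If $p>1$ and $f\in L_p(\Omega,X)$, then $$\Big\|\sup_{n_1,n_2}\|E(S_{n_1}f|F_{n_2})\|_X\Big\|_p\le\left(\frac p{p-1}\right)^2\|f\|_p.$$ 2. Let $m\ge0$ be an integer. If $f\in L(\Omega,X)[\log^+L(\Omega,X)]^{m+2}$, then $$\sup_{n_1,n_2}\|E(S_{n_1}f|F_{n_2})\|_X\in L[\log^+L]^m.$$
   Context: $X$ is a reflexive Banach space with norm $\|\cdot\|_X$, and $(\Omega,\beta,\mu)$ is a finite measure space. For $1\le p<\infty$, $L_p(\Omega,X)$ is the Banach space of (strongly) measurable functions $f:\Omega\to X$ with finite norm $\|f\|_p=\left(\int_\Omega\|f(\omega)\|_X^p\,d\mu\right)^{1/p}$; $L_p$ denotes this space for $X=\mathbb R$. For $f$ with values in $X$, $\|f\|_X$ denotes the function $\omega\mapsto\|f(\omega)\|_X$. $E(f|F)$ is the conditional expectation of $f$ with respect to a $\sigma$-subalgebra $F\subset\beta$. $F_n\downarrow F_\infty$ means that $(F_n)_{n\ge1}$ is decreasing and $F_\infty=\bigcap_nF_n$. A linear operator $T:L_1(\Omega,X)\to L_1(\Omega,X)$ is generated by an endomorphism $\tau$ (a measure-preserving transformation of $(\Omega,\beta,\mu)$)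 if $Tf=f\circ\tau$. $L(\Omega,X)[\log^+L(\Omega,X)]^m$ is the class of measurable functions $f:\Omega\to X$ with $\int_\Omega\|f\|_X[\log\max(1,\|f\|_X)]^m\,d\mu<\infty$ (for $m=0$ this is $L_1(\Omega,X)$); it is written $L[\log^+L]^m$ when $X=\mathbb R$. *)

(* Defs.v *)
From HB Require Import structures.
From mathcomp Require Import all_boot all_order all_algebra.
From mathcomp Require Import all_classical all_reals all_analysis.
From mathcomp Require Import measurable_realfun.

Set Implicit Arguments.
Unset Strict Implicit.
Unset Printing Implicit Defensive.

Import Order.TTheory GRing.Theory Num.Theory.
Import numFieldNormedType.Exports.

Local Open Scope classical_set_scope.
Local Open Scope ring_scope.

Section reflexivity.
Context {R : realType} (X : normedModType R).

Definition dual_space : set (X -> R) :=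
  [set phi : X -> R | scalar phi /\ continuous phi].

Definition dual_norm (phi : X -> R) : R :=
  sup [set `|phi x| | x in [set x : X | `|x| <= 1]].

(* A bounded linear functional on the dual is represented by a function on all
   of [X -> R], whose values outside [dual_space] are irrelevant. *)
Definition bidual_space : set ((X -> R) -> R) :=
  [set Phi : (X -> R) -> R |
    (forall (a : R) (phi psi : X -> R), dual_space phi -> dual_space psi ->
       Phi (fun x => a * phi x + psi x) = a * Phi phi + Phi psi) /\
    exists M : R, forall phi : X -> R, dual_space phi ->
      `|Phi phi| <= M * dual_norm phi].

Definition reflexive_space : Prop :=
  forall Phi : (X -> R) -> R, bidual_space Phi ->
    exists x : X, forall phi : X -> R, dual_space phi -> Phi phi = phi x.

End reflexivity.

Section strong_measurability.
Context {T : Type} {R : realType} {X : normedModType R}.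
Implicit Types G : set (set T).

Definition simple_wrt G (s : T -> X) : Prop :=
  finite_set (range s) /\ forall x : X, G (s @^-1` [set x]).

(* Functions are everywhere-defined representatives of their classes, so the
   approximating simple functions converge at every point. *)
Definition strongly_measurable G (f : T -> X) : Prop :=
  exists2 s : nat -> T -> X, (forall n, simple_wrt G (s n)) &
    forall w : T, s n w @[n --> \oo] --> f w.

Definition sup_norm {I : Type} (h : I -> T -> X) (w : T) : \bar R :=
  ereal_sup [set `|h i w|%:E | i in [set: I]].

End strong_measurability.

Section bochner.
Context d {T : measurableType d} {R : realType} {X : normedModType R}.
Variable mu : {finite_measure set T -> \bar R}.

Definition simple_integral (A : set T) (s : T -> X) : X :=
  \sum_(x \in range s) fine (mu (A `&` s @^-1` [set x])) *: x.

(* [has_bochner_integral A f v]: the Bochner integral of f over A is v. *)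
Definition has_bochner_integral (A : set T) (f : T -> X) (v : X) : Prop :=
  strongly_measurable measurable f /\
  exists s : nat -> T -> X,
    [/\ forall n, simple_wrt measurable (s n),
        (\int[mu]_(w in A) `|f w - s n w|%:E)%E @[n --> \oo] --> 0%E &
        simple_integral A (s n) @[n --> \oo] --> v].

Definition Lp_space (p : R) : set (T -> X) :=
  [set f : T -> X | strongly_measurable measurable f /\
           ('N[mu]_(p%:E)[(fun w => `|f w|%:E)] < +oo)%E].

(* [is_condexp G f g]: g is a version of E(f|G). *)
Definition is_condexp (G : set (set T)) (f g : T -> X) : Prop :=
  [/\ strongly_measurable G g, Lp_space 1 g &
      forall A : set T, G A -> exists v : X,
        has_bochner_integral A f v /\ has_bochner_integral A g v].

End bochner.

Section zygmund.
Context d {T : measurableType d} {R : realType}.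
Variable mu : {finite_measure set T -> \bar R}.
Local Open Scope ereal_scope.

(* t |-> t [log (max 1 t)]^m, with value +oo at +oo for every m. *)
Definition LlogL_weight (m : nat) (t : \bar R) : \bar R :=
  t * (lne (maxe 1 t)) ^+ m.

Definition LlogL_space {X : normedModType R} (m : nat) : set (T -> X) :=
  [set f : T -> X | strongly_measurable measurable f /\
           \int[mu]_w LlogL_weight m `|f w|%:E < +oo].

(* Version for extended real functions such as suprema; membership forces h
   to be finite almost everywhere. *)
Definition LlogL_ereal (m : nat) : set (T -> \bar R) :=
  [set h : T -> \bar R | measurable_fun setT h /\
           \int[mu]_w LlogL_weight m `|h w| < +oo].

End zygmund.

Section ergodic.
Context d {T : measurableType d} {R : realType}.

Definition endomorphism (mu : set T -> \bar R) (tau : T -> T) : Prop :=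
  measurable_fun setT tau /\
  forall A : set T, measurable A -> mu (tau @^-1` A) = mu A.

Definition generated_operator {X : Type} (tau : T -> T) (f : T -> X) : T -> X :=
  f \o tau.

Definition ergodic_average {X : normedModType R} (tau : T -> T) (n : nat)
    (f : T -> X) : T -> X :=
  fun w => n%:R^-1 *: \sum_(i < n) iter i (generated_operator tau) f w.

Definition decreasing_to (F : nat -> set (set T)) (Foo : set (set T)) : Prop :=
  nonincreasing_seq F /\ Foo = \bigcap_n F n.

End ergodic.

Definition sub_sigma_algebra_of {d} {T : measurableType d} (G : set (set T)) :
    Prop :=
  sigma_algebra setT G /\ G `<=` measurable.

(* Main.v *)
Require Import Defs.
From HB Require Import structures.
From mathcomp Require Import all_boot all_order all_algebra finmap ring lra.
From mathcomp Require Import all_classical all_reals all_analysis.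
From mathcomp Require Import measurable_realfun.

Import Order.TTheory GRing.Theory Num.Theory.
Import numFieldNormedType.Exports.

Local Open Scope classical_set_scope.
Local Open Scope ring_scope.

(** The double supremum is controlled by two maximal inequalities of the same
    shape, each followed by the same passage from a weak-type inequality to a
    norm inequality.

    Write M for the supremum over n of the norms of the averages S_n f, G for
    the double supremum in the theorem and H for the ergodic maximal function
    of the scalar function |f|, so that M <= H. Say that Y is of weak type with
    respect to Z when l mu(Y > l) <= \int_(Y > l) Z for every l > 0.

    G is of weak type with respect to M (condexp_weak_type). Fix l and a
    horizon N and split the set where some |g i k| with k <= N exceeds l
    according to the largest such k, and then according to the least i. Since
    the sigma-algebras decrease, the piece belonging to (i, k) lies in F k, so
    the Bochner integrals of g i k and of the i-th average agree on it and on
    each of its F k-measurable parts. On a part where g i k stays within e of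
    a vector y, the common integral has norm at least (l - 2 e) times the
    measure, and it is at most the integral of M over that part. Cutting the
    piece into such parts, which is possible because g i k is strongly
    measurable, and letting e tend to 0 gives the claim.

    H is of weak type with respect to |f| (maximal_ergodic), by Garsia's
    argument: the maximum V of the first partial sums of |f| - l along the
    orbit satisfies V + l <= |f| + V o tau where V > 0, and integrating cancels
    V against V o tau.

    Weak type implies norm inequalities by slicing the values of Y. In L_p
    (weak_type_Lnorm) the slices are those of an arithmetic grid: replacing Y
    by its rounding D on the grid, the elementary inequality
    a^p - b^p <= p/(p-1) a (a^(p-1) - b^(p-1)) for 0 <= b <= a is exactly what
    is needed to obtain \int D^p <= p/(p-1) \int Z D^(p-1) with the sharp
    constant, and Hoelder's inequality finishes. In the Zygmund classes
    (weak_type_LlogL) the slices are at the levels l = e^k, where the bound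
    (l/2) mu(Y > l) <= \int_(Z > l/2) Z shows that one logarithm is lost.

    Applying the passage to (H, |f|) and then to (G, M) gives the constant
    (p/(p-1))^2 in the first case, and the loss of two logarithms in the
    second. *)

(** * Sets on which one function dominates a level *)

Section dominated_sets.
Set Implicit Arguments. Unset Strict Implicit.
Local Open Scope ereal_scope.
Context d {T : measurableType d} {R : realType}.
Context (mu : {finite_measure set T -> \bar R}).
Implicit Types (l : R) (Y Z : T -> \bar R) (A : set T).

Lemma measurable_gt l Y : measurable_fun setT Y -> measurable [set w | l%:E < Y w].
Proof.
by move=> mY; rewrite -[X in measurable X]setTI; exact: emeasurable_fun_o_infty.
Qed.

Lemma finite_measure_EFin A : measurable A ->
  exists2 c : R, (0 <= c)%R & mu A = c%:E.
Proof.
by move=> mA; exists (fine (mu A)); rewrite ?fine_ge0// fineK// fin_num_measure.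
Qed.

(** When mu(A) > 0, this says that l is at most the mean of Z over A; without
    the quotient it makes sense for null sets, which the decompositions below
    may produce. *)
Definition dominated_on l Z A : Prop := l%:E * mu A <= \int[mu]_(w in A) Z w.

(** This is slightly stronger than the weak-type bound l mu(Y > l) <= \int Z: the
    integral extends over the level set only. That localization is what
    upgrades to the L_p norm and to the Zygmund classes. *)
Definition weak_type Y Z : Prop :=
  forall l, (0 < l)%R -> dominated_on l Z [set w | l%:E < Y w].

Lemma dominated_on_trivIset l Z (A : (set T)^nat) :
  (0 <= l)%R -> measurable_fun setT Z -> (forall w, 0 <= Z w) ->
  (forall i, measurable (A i)) -> trivIset setT A ->
  (forall i, dominated_on l Z (A i)) -> dominated_on l Z (\bigcup_i A i).
Proof.
move=> l0 mZ Z0 mA tA lA; rewrite /dominated_on.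
rewrite ge0_integral_bigcup//; last exact: measurable_funTS.
rewrite measure_bigcup// -nneseriesZl//.
under [leLHS]eq_eseriesl do rewrite in_setT.
by apply: lee_nneseries => *; [exact: mule_ge0|exact: lA].
Qed.

Lemma dominated_on_fibers l Z A (c : T -> nat) :
  (0 <= l)%R -> measurable_fun setT Z -> (forall w, 0 <= Z w) ->
  measurable A -> (forall i, measurable (c @^-1` [set i])) ->
  (forall i, dominated_on l Z (A `&` c @^-1` [set i])) -> dominated_on l Z A.
Proof.
move=> l0 mZ Z0 mA mc lAc.
have -> : A = \bigcup_i (A `&` c @^-1` [set i]).
  by apply/seteqP; split=> [w Aw|w [i _ []//]]; exists (c w).
apply: dominated_on_trivIset => // [i|]; first exact: measurableI.
exact: trivIset_preimage1_in.
Qed.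

(** The set seqDU A i consists of the points of the union whose least index is
    i. This is how the set where a maximal function exceeds a level is cut
    according to the first function that does so. *)
Lemma dominated_on_seqDU l Z (A : (set T)^nat) :
  (0 <= l)%R -> measurable_fun setT Z -> (forall w, 0 <= Z w) ->
  (forall i, measurable (A i)) ->
  (forall i, dominated_on l Z (seqDU A i)) -> dominated_on l Z (\bigcup_i A i).
Proof.
move=> l0 mZ Z0 mA lA; rewrite seqDU_bigcup_eq.
apply: dominated_on_trivIset => // i; exact: seqDU_measurable.
Qed.

Lemma dominated_on_bigcup l Z (A : (set T)^nat) :
  measurable_fun setT Z -> (forall w, 0 <= Z w) ->
  (forall n, measurable (A n)) -> nondecreasing_seq A ->
  (forall n, dominated_on l Z (A n)) -> dominated_on l Z (\bigcup_n A n).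
Proof.
move=> mZ Z0 mA ndA lA; rewrite /dominated_on.
have mbA : measurable (\bigcup_n A n) by exact: bigcup_measurable.
have h : l%:E * mu (A n) @[n --> \oo] --> l%:E * mu (\bigcup_n A n).
  by apply: cvgeZl => //; apply: nondecreasing_cvg_mu.
apply: (cvge_to_le h); apply: nearW => n.
apply: le_trans (lA n) _; apply: ge0_subset_integral => //.
  exact: measurable_funTS.
exact: bigcup_sup.
Qed.

End dominated_sets.

(** * Bochner integrals against constants *)

Section simple_functions.
Set Implicit Arguments. Unset Strict Implicit.
Context d {T : measurableType d} {R : realType} {X : normedModType R}.
Implicit Types (s t f : T -> X) (A : set T) (x : X).

(** A pair of simple functions pulls back every subset of X * X to a finite
    union of intersections of fibers. Pairs serve to measure the distance
    between two approximants of the same function. *)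
Lemma simple_wrt_pair_measurable s t (P : set (X * X)) :
  simple_wrt measurable s -> simple_wrt measurable t ->
  measurable [set w | P (s w, t w)].
Proof.
move=> [fs ms] [ft mt].
rewrite (_ : [set w | _] = \bigcup_(z in (range s `*` range t) `&` P)
    (s @^-1` [set z.1] `&` t @^-1` [set z.2])); last first.
  apply/seteqP; split=> [w Pw|w [[y z] /= [_ Pyz] [-> ->]]//].
  by exists (s w, t w) => //; split=> //; split; exists w.
apply: fin_bigcup_measurable.
  exact/finite_setIl/finite_setX.
by move=> z _; exact: measurableI.
Qed.

Lemma simple_wrt_norm_measurable s x :
  simple_wrt measurable s -> measurable_fun setT (fun w => `|s w - x|).
Proof.
move=> hs _ B _; rewrite setTI.
exact: (@simple_wrt_pair_measurable s s [set z | B `|z.1 - x|]).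
Qed.

Lemma strongly_measurable_norm f x : strongly_measurable measurable f ->
  measurable_fun setT (fun w => `|f w - x|%:E).
Proof.
move=> [s hs sf].
apply: (@emeasurable_fun_cvg _ _ _ _ (fun n w => `|s n w - x|%:E)).
  by move=> n; apply/measurable_EFinP; exact: simple_wrt_norm_measurable.
move=> w _; apply: cvg_EFin; first exact: nearW.
by apply: cvg_norm; apply: cvgB => //; exact: cvg_cst.
Qed.

End simple_functions.

Section bochner_estimate.
Set Implicit Arguments. Unset Strict Implicit.
Context d {T : measurableType d} {R : realType} {X : normedModType R}.
Context (mu : {finite_measure set T -> \bar R}).
Implicit Types (s t f : T -> X) (A : set T) (x v : X).

Local Lemma integral_simple_split s A (h : T -> \bar R) :
  simple_wrt measurable s -> measurable A -> measurable_fun setT h ->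
  (forall w, 0 <= h w)%E ->
  (\int[mu]_(w in A) h w = \sum_(y <- fset_set (range s))
     \int[mu]_(w in A `&` s @^-1` [set y]) h w)%E.
Proof.
move=> [fs ms] mA mh h0.
have AE : A = \big[setU/set0]_(y <- fset_set (range s)) (A `&` s @^-1` [set y]).
  rewrite -bigcup_seq; apply/seteqP; split=> [w Aw|w [y _ []//]].
  by exists (s w) => //=; rewrite in_fset_set//; apply/mem_set; exists w.
rewrite {1}AE ge0_integral_bigsetU//.
- by move=> y; exact: measurableI.
- exact: trivIset_preimage1_in.
- exact: measurable_funTS.
Qed.

(** Over the finitely many values y of s, with A_y the part of A where s is y,
    the two sides read |\sum_y mu(A_y) (y - x)| and \sum_y mu(A_y) |y - x|. *)
Lemma simple_integral_dist s A x : simple_wrt measurable s -> measurable A ->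
  (`|simple_integral mu A s - fine (mu A) *: x|%:E <=
     \int[mu]_(w in A) `|s w - x|%:E)%E.
Proof.
move=> hs mA; have [fs ms] := hs.
have muf B : measurable B -> mu B = (fine (mu B))%:E.
  by move=> mB; rewrite fineK// fin_num_measure.
have mAs y : measurable (A `&` s @^-1` [set y]) by exact: measurableI.
have muA : fine (mu A) = \sum_(y <- fset_set (range s))
    fine (mu (A `&` s @^-1` [set y])).
  have mu1 : mu A = (\sum_(y <- fset_set (range s))
      (fine (mu (A `&` s @^-1` [set y])))%:E)%E.
    rewrite -[LHS]mul1e -(integral_cst mu mA) (integral_simple_split hs mA)//.
    by apply: eq_bigr => y _; rewrite integral_cst// mul1e; exact: muf.
  by apply: EFin_inj; rewrite -muf// -sumEFin mu1.
rewrite (integral_simple_split hs mA)//; last first.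
  by apply/measurable_EFinP; exact: simple_wrt_norm_measurable.
rewrite /simple_integral fsbig_finite//= muA scaler_suml -sumrB.
rewrite (eq_bigr (fun y => fine (mu (A `&` s @^-1` [set y])) *: (y - x)));
  last by move=> y _; rewrite scalerBr.
have -> : (\sum_(y <- fset_set (range s))
     \int[mu]_(w in A `&` s @^-1` [set y]) `|s w - x|%:E =
   (\sum_(y <- fset_set (range s))
     fine (mu (A `&` s @^-1` [set y])) * `|y - x|)%:E)%E.
  rewrite -sumEFin; apply: eq_bigr => y _.
  rewrite (eq_integral (cst `|y - x|%:E)); last first.
    by move=> w /[!inE] -[_ /= ->].
  by rewrite integral_cst// EFinM muleC; congr (_ * _)%E; exact: muf.
rewrite lee_fin; apply: le_trans (ler_norm_sum _ _ _) _.
apply: ler_sum => y _; rewrite normrZ ger0_norm//; exact: fine_ge0.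
Qed.

(** The previous bound in the limit of simple functions. With x = 0 it is the
    norm inequality for the Bochner integral; with x close to the values of f
    it says that the integral is close to mu(A) x, which bounds the norm of the
    integral from below. *)
Lemma bochner_integral_dist f A v x :
  has_bochner_integral mu A f v -> measurable A ->
  (`|v - fine (mu A) *: x|%:E <= \int[mu]_(w in A) `|f w - x|%:E)%E.
Proof.
move=> [sf [s [ss s0 sv]]] mA.
have mfx : measurable_fun A (fun w => `|f w - x|%:E).
  by apply: measurable_funTS; exact: strongly_measurable_norm.
have mfs n : measurable_fun A (fun w => `|f w - s n w|%:E).
  apply: measurable_funTS; case: sf => t ht tf.
  apply: (@emeasurable_fun_cvg _ _ _ _ (fun m w => `|t m w - s n w|%:E)).
    move=> m; apply/measurable_EFinP => _ B _; rewrite setTI.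
    exact: (@simple_wrt_pair_measurable _ _ _ _ _ _ [set z | B `|z.1 - z.2|]).
  move=> w _; apply: cvg_EFin; first exact: nearW.
  by apply: cvg_norm; apply: cvgB => //; exact: cvg_cst.
have lhs : `|simple_integral mu A (s n) - fine (mu A) *: x|%:E
    @[n --> \oo] --> `|v - fine (mu A) *: x|%:E.
  apply: cvg_EFin; first exact: nearW.
  by apply: cvg_norm; apply: cvgB => //; exact: cvg_cst.
have rhs : (\int[mu]_(w in A) `|f w - x|%:E +
    \int[mu]_(w in A) `|f w - s n w|%:E)%E @[n --> \oo] -->
    (\int[mu]_(w in A) `|f w - x|%:E + 0)%E.
  apply: cvgeD => //; first by rewrite fin_num_adde_defl.
  exact: cvg_cst.
rewrite -[leRHS]adde0; apply: (lee_cvg_to lhs rhs); apply: nearW => n.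
apply: le_trans (simple_integral_dist x (ss n) mA) _.
rewrite -ge0_integralD//; apply: ge0_le_integral => //.
- by apply: measurable_funTS; apply/measurable_EFinP; exact: simple_wrt_norm_measurable.
- exact: emeasurable_funD.
- move=> w _; rewrite -EFinD lee_fin.
  have -> : s n w - x = (f w - x) - (f w - s n w) by rewrite opprB [RHS]addrC subrKA.
  exact: ler_normB.
Qed.

End bochner_estimate.

(** * Maximal inequality for conditional expectations *)

Section conditional_expectation.
Set Implicit Arguments. Unset Strict Implicit.
Local Open Scope ereal_scope.
Context d {T : measurableType d} {R : realType} {X : normedModType R}.
Context (mu : {finite_measure set T -> \bar R}).
Implicit Types (l e : R) (Z : T -> \bar R) (phi g : T -> X) (A : set T).

Local Lemma integral_EFin_cst A (c r : R) : measurable A -> mu A = c%:E ->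
  \int[mu]_(w in A) r%:E = (r * c)%:E.
Proof. by move=> mA mc; rewrite integral_cst// EFinM; congr (_ * _). Qed.

(** Since mu(A) is finite, an arbitrarily small constant added to Z changes the
    integral over A arbitrarily little. *)
Lemma dominated_on_addr l Z A : measurable_fun setT Z -> (forall w, 0 <= Z w) ->
  measurable A ->
  (forall e, (0 < e)%R -> dominated_on mu l (fun w => Z w + e%:E) A) ->
  dominated_on mu l Z A.
Proof.
move=> mZ Z0 mA lZ; apply/lee_addgt0Pr => e e0.
have [c c0 mc] := finite_measure_EFin mu mA.
have e'0 : (0 < e / (c + 1))%R by rewrite divr_gt0// ltr_wpDl.
apply: le_trans (lZ _ e'0) _.
rewrite ge0_integralD//; last 2 first.
  exact: measurable_funTS.
  by move=> w _; rewrite lee_fin ltW.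
rewrite leeD2l// (integral_EFin_cst _ mA mc) lee_fin.
by rewrite mulrAC ler_pdivrMr ?ltr_wpDl// ler_pM2l// lerDl.
Qed.

(** Let v be the common integral of phi and g over A, and c the measure of A.
    Then l c <= (|y| + e) c, because |g| >= l and |g - y| <= e on A, and
    |c y| <= |v| + |v - c y| <= \int_A |phi| + e c. *)
Lemma condexp_dominated_on_ball (G : set (set T)) phi g Z l e y A :
  is_condexp mu G phi g -> measurable_fun setT Z ->
  (forall w, `|phi w|%:E <= Z w) -> G A -> measurable A -> (0 <= e)%R ->
  (forall w, A w -> (`|g w - y| <= e)%R) ->
  (forall w, A w -> (l <= `|g w|)%R) ->
  dominated_on mu l (fun w => Z w + (e + e)%:E) A.
Proof.
move=> [sg _ hg] mZ phiZ GA mA e0 gy lg; rewrite /dominated_on.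
have Z0 w : 0 <= Z w by apply: le_trans (phiZ w); rewrite lee_fin.
have [c c0 mc] := finite_measure_EFin mu mA.
have [v [phiv gv]] := hg _ GA.
rewrite ge0_integralD//; last 2 first.
  exact: measurable_funTS.
  by move=> w _; rewrite lee_fin addr_ge0.
rewrite (integral_EFin_cst _ mA mc) mc -EFinM.
have [A0|/set0P[w0 Aw0]] := eqVneq A set0.
  (* On the empty set nothing relates l and y, but both sides vanish there. *)
  have -> : c = 0%R by apply: EFin_inj; rewrite -mc A0 measure0.
  by rewrite !mulr0 adde0; exact: integral_ge0.
have v_le : `|v|%:E <= \int[mu]_(w in A) Z w.
  have := bochner_integral_dist 0%R phiv mA.
  rewrite scaler0 subr0 => /le_trans; apply.
  apply: ge0_le_integral => //.
  - by apply: measurable_funTS; exact: strongly_measurable_norm phiv.1.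
  - exact: measurable_funTS.
  - by move=> w _; rewrite subr0.
have vy_le : (`|v - c *: y| <= e * c)%R.
  rewrite -lee_fin -(integral_EFin_cst e mA mc) (_ : c = fine (mu A));
    last by rewrite mc.
  apply: le_trans (bochner_integral_dist y gv mA) _.
  apply: ge0_le_integral => //.
  by apply: measurable_funTS; exact: strongly_measurable_norm gv.1.
apply: (@le_trans _ _ (`|v| + (e + e) * c)%:E); last by rewrite EFinD leeD2r.
rewrite lee_fin.
have ly : (l <= `|y| + e)%R.
  apply: le_trans (lg _ Aw0) _.
  by rewrite -[g w0](subrK y) addrC (le_trans (ler_normD _ _))// lerD2l gy.
apply: le_trans (ler_wpM2r c0 ly) _.
rewrite !mulrDl addrA lerD2r.
have -> : (`|y| * c = `|v - (v - c *: y)|)%R.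
  by rewrite subKr normrZ ger0_norm// mulrC.
by apply: le_trans (ler_normB _ _) _; rewrite lerD2l.
Qed.

(** The set A is cut into G-measurable pieces on which g is within e / 2 of a
    constant, which is what strong measurability of g with respect to G
    provides; each piece is covered by the previous lemma. *)
Lemma condexp_dominated_on (G : set (set T)) phi g Z l A :
  sub_sigma_algebra_of G -> is_condexp mu G phi g -> measurable_fun setT Z ->
  (forall w, `|phi w|%:E <= Z w) -> G A -> (0 <= l)%R ->
  (forall w, A w -> (l <= `|g w|)%R) -> dominated_on mu l Z A.
Proof.
move=> [sG Gm] hg mZ phiZ GA l0 lg.
have Z0 w : 0 <= Z w by apply: le_trans (phiZ w); rewrite lee_fin.
have GE := measurable_g_measurableTypeE sG.
apply: dominated_on_addr => //; first exact: Gm.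
move=> e e0; have [[s ss sg] _ _] := hg.
have {}ss n : simple_wrt G.-sigma.-measurable (s n) by rewrite GE.
(* On C n the limit g is within e / 2 of the simple function s n. Defining C n
   by the Cauchy condition makes its membership in G plain and makes the
   sequence C nondecreasing. *)
pose C n := [set w | forall i j, (n <= i)%N -> (n <= j)%N ->
  (`|s i w - s j w| <= e / 2)%R].
have GC n : G (A `&` C n).
  rewrite -GE; apply: measurableI; first by rewrite GE.
  rewrite (_ : C n = \bigcap_(i in [set i | (n <= i)%N])
    \bigcap_(j in [set j | (n <= j)%N]) [set w | (`|s i w - s j w| <= e / 2)%R]).
    apply: bigcap_measurableType => i _; apply: bigcap_measurableType => j _.
    exact: (simple_wrt_pair_measurable [set z | (`|z.1 - z.2| <= e / 2)%R]).
  apply/seteqP; split=> w Cw i; first by move=> ni j; exact: Cw.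
  by move=> j ni nj; exact: Cw.
have -> : A = \bigcup_n (A `&` C n).
  apply/seteqP; split=> [w Aw|w [n _ []//]].
  have e4 : (0 < e / 2 / 2)%R by rewrite !divr_gt0.
  have /cvgrPdist_le/(_ _ e4)[n _ gs] := sg w.
  exists n => //; split=> // i j ni nj.
  rewrite [(e / 2)%R]splitr (_ : (s i w - s j w = (g w - s j w) - (g w - s i w))%R);
    last by rewrite opprB [RHS]addrC subrKA.
  by apply: le_trans (ler_normB _ _) _; apply: lerD; exact: gs.
have mZe : measurable_fun setT (fun w => Z w + e%:E) by exact: emeasurable_funD.
have Ze0 w : 0 <= Z w + e%:E by rewrite adde_ge0// lee_fin ltW.
apply: dominated_on_bigcup => //.
- by move=> n; exact: Gm.
- move=> m n mn; apply/subsetPset => w [Aw Cw]; split=> // i j ni nj.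
  by apply: Cw; exact: leq_trans mn _.
(* The fibers of s n are indexed by the positions of its values in r. *)
move=> n; pose r : seq X := fset_set (range (s n)).
have sr w : s n w \in r.
  by rewrite in_fset_set//; [apply/mem_set; exists w|case: (ss n)].
have Gfib i : G ((fun w => index (s n w) r) @^-1` [set i]).
  rewrite -GE.
  exact: (simple_wrt_pair_measurable [set z | index z.1 r = i] (ss n) (ss n)).
apply: (@dominated_on_fibers _ _ _ _ _ _ _ (fun w => index (s n w) r)) => //.
- exact: Gm.
- by move=> i; exact: Gm.
move=> i; set B := _ `&` _.
have GB : G B by rewrite -GE; apply: measurableI; rewrite GE.
rewrite [X in X%:E]splitr.
apply: (condexp_dominated_on_ball (y := nth 0%R r i) hg) => //.
- exact: Gm.
- by rewrite divr_ge0// ltW.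
- move=> w [[Aw Cw] /= <-]; rewrite nth_index//.
  have gs : `|s m w - s n w|%R @[m --> \oo] --> `|g w - s n w|%R.
    by apply: cvg_norm; apply: cvgB => //; exact: cvg_cst.
  apply: (cvgr_to_le gs); exists n => // m /= nm; exact: Cw.
- by move=> w [[/lg]].
Qed.

(** A reverse-time stopping argument: because F decreases, the last k <= N for
    which the level is exceeded is determined by F k, exactly as the first
    such time would be for an increasing filtration. *)
Theorem condexp_weak_type (F : nat -> set (set T)) (phi : nat -> T -> X)
    (g : nat -> nat -> T -> X) Z :
  nonincreasing_seq F -> (forall k, sub_sigma_algebra_of (F k)) ->
  (forall i k, is_condexp mu (F k) (phi i) (g i k)) -> measurable_fun setT Z ->
  (forall i w, `|phi i w|%:E <= Z w) ->
  weak_type mu (sup_norm (fun n : nat * nat => g n.1 n.2)) Z.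
Proof.
move=> ndF sF hg mZ phiZ l l0.
have Z0 w : 0 <= Z w by apply: le_trans (phiZ 0%N w); rewrite lee_fin.
have FE k := measurable_g_measurableTypeE (sF k).1.
pose D i k := [set w | (l < `|g i k w|)%R].
have FD i k : F k (D i k).
  have [[s ss sg] _ _] := hg i k.
  have mg : strongly_measurable (F k).-sigma.-measurable (g i k).
    by exists s => // n; rewrite FE.
  have mgn := strongly_measurable_norm (T := g_sigma_algebraType (F k)) 0%R mg.
  have := emeasurable_fun_o_infty measurableT mgn l%:E.
  rewrite setTI FE; congr (F k _).
  by apply/seteqP; split=> w /=; rewrite subr0 lte_fin.
pose E k := \bigcup_i D i k.
have FEk k : F k (E k).
  by rewrite -FE; apply: bigcupT_measurable => i; rewrite FE.
(* The sets H N 0, ..., H N N are E N, ..., E 0: in this order the least index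
   marks the last k <= N for which the level is exceeded. *)
pose H N j := if (j <= N)%N then E (N - j)%N else set0.
have -> : [set w | l%:E < sup_norm (fun n : nat * nat => g n.1 n.2) w] =
    \bigcup_N \bigcup_j H N j.
  apply/seteqP; split=> [w /ereal_sup_gt[_ [[i k] _ <-]]|w [N _ [j _]]] /=.
    rewrite lte_fin => lg; exists k => //; exists 0%N => //.
    by rewrite /H subn0; exists i.
  rewrite /H; case: ifP => // _ [i _ lg].
  apply: (@lt_le_trans _ _ `|g i (N - j)%N w|%:E); first by rewrite lte_fin.
  by apply: ereal_sup_ubound; exists (i, (N - j)%N).
have mH N j : measurable (H N j) by rewrite /H; case: ifP => // _; exact: (sF _).2.
apply: dominated_on_bigcup => //.
- by move=> N; exact: bigcupT_measurable.
- move=> M N MN; apply/subsetPset => w [j _]; rewrite /H; case: ifP => // jM Ew.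
  exists (j + (N - M))%N => //.
  have -> : (j + (N - M) <= N)%N by rewrite addnBA// leq_subLR leq_add2r.
  by rewrite subnDA subnAC subKn.
move=> N; apply: dominated_on_seqDU => //; first exact: ltW.
move=> j; have [jN|jN] := leqP j N; last first.
  rewrite /seqDU /H leqNgt jN/= set0D /dominated_on measure0 mule0.
  exact: integral_ge0.
(* Being outside E N, ..., E (N - j + 1) belongs to F (N - j), which contains
   all of F N, ..., F (N - j + 1). *)
have FHj : F (N - j)%N (seqDU (H N) j).
  rewrite -FE; apply: measurableD; first by rewrite /H jN FE.
  apply: bigsetU_measurable => i _; rewrite FE.
  rewrite /H (leq_trans (ltnW (ltn_ord i)) jN).
  have /subsetPset : (F (N - i)%N <= F (N - j)%N)%O.
    by apply: ndF; apply: leq_sub2l; exact/ltnW/ltn_ord.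
  exact.
have -> : seqDU (H N) j = \bigcup_i (seqDU (H N) j `&` D i (N - j)%N).
  rewrite -setI_bigcupr; apply/esym/setIidPl => w [+ _].
  by rewrite /H jN.
apply: dominated_on_seqDU => //; first exact: ltW.
  by move=> i; apply: (sF (N - j)%N).2; rewrite -FE; apply: measurableI; rewrite FE.
move=> i; apply: (condexp_dominated_on (sF (N - j)%N) (hg i _)) => //.
- rewrite -FE; apply: (seqDU_measurable (T := g_sigma_algebraType _)) => k.
  by apply: measurableI; rewrite FE.
- exact: ltW.
- by move=> w [[_ /ltW]].
Qed.

End conditional_expectation.

(** * Maximal ergodic inequality *)

Section maximal_ergodic.
Set Implicit Arguments. Unset Strict Implicit.
Local Open Scope ereal_scope.
Context d {T : measurableType d} {R : realType}.
Context (mu : {finite_measure set T -> \bar R}) (tau : T -> T).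
Context (htau : endomorphism mu tau).
Implicit Types (l : R) (h : T -> R).

Let mtau : measurable_fun setT tau := htau.1.

Lemma ge0_integral_endomorphism (V : T -> \bar R) :
  measurable_fun setT V -> (forall w, 0 <= V w) ->
  \int[mu]_w V (tau w) = \int[mu]_w V w.
Proof.
move=> mV V0.
have := ge0_integral_pushforward mtau mu measurableT mV (fun y _ => V0 y).
rewrite preimage_setT => <-; apply: eq_measure_integral => A mA _.
exact: htau.2.
Qed.

(** The largest of the sums orbit_sum 0, ..., orbit_sum N, the first of which is
    0. The recursion through tau, rather than a maximum over indices, is the
    identity on which Garsia's argument rests. *)
Fixpoint max_sum l h (N : nat) (w : T) : R :=
  if N is N'.+1 then Num.max 0%R (h w - l + max_sum l h N' (tau w))%R else 0%R.

Definition orbit_sum l h (n : nat) (w : T) : R :=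
  (\sum_(i < n) (h (iter i tau w) - l))%R.

Lemma orbit_sumS l h n w :
  orbit_sum l h n.+1 w = (h w - l + orbit_sum l h n (tau w))%R.
Proof.
rewrite /orbit_sum big_ord_recl; congr (_ + _)%R; apply: eq_bigr => i _.
by rewrite -iterSr.
Qed.

Lemma max_sum_ge0 l h N w : (0 <= max_sum l h N w)%R.
Proof. by case: N => //= N; rewrite le_max lexx. Qed.

Lemma max_sum_nondecreasing l h N w : (max_sum l h N w <= max_sum l h N.+1 w)%R.
Proof.
elim: N w => [|N IH] w; first exact: max_sum_ge0.
by rewrite [leRHS]/= [leLHS]/= ge_max !le_max lexx /= lerD2l IH orbT.
Qed.

Lemma orbit_sum_le_max_sum l h n w : (orbit_sum l h n w <= max_sum l h n w)%R.
Proof.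
elim: n w => [|n IH] w; first by rewrite /orbit_sum big_ord0.
by rewrite orbit_sumS /= le_max lerD2l IH orbT.
Qed.

Lemma max_sum_attained l h N w : exists n, max_sum l h N w = orbit_sum l h n w.
Proof.
elim: N w => [|N IH] w /=; first by exists 0%N; rewrite /orbit_sum big_ord0.
rewrite /Num.max; case: ifP => _; last by exists 0%N; rewrite /orbit_sum big_ord0.
by have [n ->] := IH (tau w); exists n.+1; rewrite orbit_sumS.
Qed.

Lemma measurable_max_sum l h N : measurable_fun setT h ->
  measurable_fun setT (max_sum l h N).
Proof.
move=> mh; elim: N => [|N IH] //=; apply: measurable_maxr => //.
apply: measurable_funD; first exact: measurable_funB.
exact: measurableT_comp.
Qed.

Lemma integral_max_sum_lty l h N : measurable_fun setT h -> (forall w, 0 <= h w)%R ->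
  (0 <= l)%R -> \int[mu]_w (h w)%:E < +oo -> \int[mu]_w (max_sum l h N w)%:E < +oo.
Proof.
move=> mh h0 l0 ih; elim: N => [|N IH]; first by rewrite integral0 ltry.
have mV := measurable_max_sum l N mh.
apply: (@le_lt_trans _ _ (\int[mu]_w ((h w)%:E + (max_sum l h N (tau w))%:E))).
  apply: ge0_le_integral => //.
  - by move=> w _; rewrite lee_fin max_sum_ge0.
  - by apply/measurable_EFinP; exact: measurable_max_sum.
  - by apply: emeasurable_funD; apply/measurable_EFinP => //; exact: measurableT_comp.
  move=> w _; rewrite -EFinD lee_fin /= ge_max.
  by rewrite addr_ge0 ?max_sum_ge0//= lerD2r lerBlDr lerDl.
rewrite ge0_integralD//.
- rewrite (@ge0_integral_endomorphism (EFin \o max_sum l h N)).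
  + by rewrite lte_add_pinfty.
  + exact/measurable_EFinP.
  + by move=> w; rewrite lee_fin max_sum_ge0.
- by move=> w _; rewrite lee_fin.
- exact/measurable_EFinP.
- by move=> w _; rewrite lee_fin max_sum_ge0.
- by apply/measurable_EFinP; exact: measurableT_comp.
Qed.

(** Garsia's argument. Write V for max_sum N. Where V > 0 the recursion gives
    V + l <= h + V o tau, since V grows with N. Integrate over that set E: the
    integral of V over E is all of \int V, and that of V o tau is at most \int V
    by invariance, so the two cancel, \int V being finite. *)
Lemma max_sum_dominated_on l h N : measurable_fun setT h -> (forall w, 0 <= h w)%R ->
  (0 <= l)%R -> \int[mu]_w (h w)%:E < +oo ->
  dominated_on mu l (EFin \o h) [set w | (0 < max_sum l h N w)%R].
Proof.
move=> mh h0 l0 ih; set E := [set w | _]; rewrite /dominated_on.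
have mV := measurable_max_sum l N mh.
have mEV : measurable_fun setT (EFin \o max_sum l h N) by exact/measurable_EFinP.
have mEVt : measurable_fun setT (EFin \o max_sum l h N \o tau).
  exact: measurableT_comp.
have V0 w : 0 <= (max_sum l h N w)%:E by rewrite lee_fin max_sum_ge0.
have h0E w : E w -> 0 <= (h w)%:E by rewrite lee_fin.
have mE : measurable E by exact: (measurable_gt 0%R mEV).
have mhE : measurable_fun E (EFin \o h).
  by apply: measurable_funTS; exact/measurable_EFinP.
have EV : \int[mu]_w (max_sum l h N w)%:E = \int[mu]_(w in E) (max_sum l h N w)%:E.
  rewrite [RHS]integral_mkcond; apply: eq_integral => w _.
  rewrite patchE; case: ifPn => // /negP; rewrite inE /E /= => /negP.
  rewrite -leNgt => V_le0; congr EFin; apply/eqP.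
  by rewrite eq_le V_le0 max_sum_ge0.
have Vfin : \int[mu]_w (max_sum l h N w)%:E \is a fin_num.
  rewrite ge0_fin_numE; first exact: integral_max_sum_lty.
  exact: integral_ge0.
rewrite -(leeD2rE _ _ Vfin) {1}EV.
apply: (@le_trans _ _ (\int[mu]_(w in E) (l%:E + (max_sum l h N w)%:E))).
  rewrite ge0_integralD//; last exact: measurable_funTS.
  by rewrite integral_cst.
apply: (@le_trans _ _ (\int[mu]_(w in E) ((h w)%:E + (max_sum l h N (tau w))%:E))).
  apply: ge0_le_integral => //.
  - by move=> w _; rewrite adde_ge0.
  - by apply: emeasurable_funD => //; exact: measurable_funTS.
  - by apply: emeasurable_funD => //; exact: (measurable_funTS mEVt).
  move=> w; rewrite /E -!EFinD lee_fin /=.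
  case: N {mV mEV mEVt V0 mE mhE EV Vfin h0E E} => [|N].
    by rewrite ltxx.
  rewrite [max_sum l h N.+1 w]/= lt_max ltxx/= => Vw.
  rewrite max_r; last exact: ltW.
  by rewrite addrA subrKC lerD2l max_sum_nondecreasing.
rewrite ge0_integralD//; last exact: (measurable_funTS mEVt).
rewrite leeD2l// -(ge0_integral_endomorphism mEV V0).
exact: ge0_subset_integral.
Qed.

(** Some average up to time N exceeds l exactly when some orbit sum of h - l up
    to time N is positive, that is, when max_sum N is. *)
Theorem maximal_ergodic h : measurable_fun setT h -> (forall w, 0 <= h w)%R ->
  \int[mu]_w (h w)%:E < +oo ->
  weak_type mu (fun w => ereal_sup
    (range (fun n => (n.+1%:R^-1 * \sum_(i < n.+1) h (iter i tau w))%:E))) (EFin \o h).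
Proof.
move=> mh h0 ih l l0.
have orbit_sum_gt0 n w : (0 < orbit_sum l h n.+1 w)%R =
    (l < n.+1%:R^-1 * \sum_(i < n.+1) h (iter i tau w))%R.
  rewrite /orbit_sum sumrB sumr_const card_ord subr_gt0.
  by rewrite -[in LHS]mulr_natl ltr_pdivlMl.
have -> : [set w | l%:E < ereal_sup
    (range (fun n => (n.+1%:R^-1 * \sum_(i < n.+1) h (iter i tau w))%:E))] =
    \bigcup_N [set w | (0 < max_sum l h N w)%R].
  apply/seteqP; split=> w.
    move=> /ereal_sup_gt[_ [n _ <-]]; rewrite lte_fin -orbit_sum_gt0 => lw.
    by exists n.+1 => //; exact: lt_le_trans lw (orbit_sum_le_max_sum _ _ _ _).
  move=> [N _ /=]; have [[|n] ->] := max_sum_attained l h N w.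
    by rewrite /orbit_sum big_ord0 ltxx.
  rewrite orbit_sum_gt0 -lte_fin => /lt_le_trans; apply.
  by apply: ereal_sup_ubound; exists n.
apply: dominated_on_bigcup => //.
- exact/measurable_EFinP.
- move=> N; rewrite -[X in measurable X]setTI -preimage_itvoy.
  exact: measurable_max_sum.
- apply/nondecreasing_seqP => N; apply/subsetPset => w /= /lt_le_trans; apply.
  exact: max_sum_nondecreasing.
by move=> N; apply: max_sum_dominated_on => //; exact: ltW.
Qed.

End maximal_ergodic.

(** * Slicing along an arithmetic grid *)

Section layers.
Set Implicit Arguments. Unset Strict Implicit.
Local Open Scope ereal_scope.
Context d {T : measurableType d} {R : realType}.
Context (mu : {finite_measure set T -> \bar R}).
Implicit Types (delta : R) (Y Z : T -> \bar R) (u : T -> R).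

(** After multiplication by p - 1 this is p a b^(p-1) <= a^p + (p-1) b^p, which
    is Young's inequality for a and b^(p-1). It is the discrete counterpart of
    d(t^p) = p/(p-1) t d(t^(p-1)), and it loses no constant on any grid. *)
Lemma powR_increment (p a b : R) : (1 < p -> 0 <= b -> b <= a ->
  a `^ p - b `^ p <= p / (p - 1) * (a `^ (p - 1) - b `^ (p - 1)) * a)%R.
Proof.
move=> p1 b0 ba; have a0 : (0 <= a)%R by exact: le_trans ba.
have p0 : (0 < p)%R by exact: lt_trans p1.
have p10 : (0 < p - 1)%R by rewrite subr_gt0.
have pn0 : p != 0%R by rewrite gt_eqF.
have p1n0 : (p - 1)%R != 0%R by rewrite gt_eqF.
have pS (x : R) : (0 <= x)%R -> (x `^ (p - 1) * x = x `^ p)%R.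
  move=> x0; have [->|xn0] := eqVneq x 0%R; first by rewrite mulr0 powR0.
  by rewrite -{2}(powRr1 x0) -powRD ?subrK//; apply/implyP.
have q0 : (0 < p / (p - 1))%R by rewrite divr_gt0.
have pq : (p^-1 + (p / (p - 1))^-1 = 1)%R by field; rewrite p1n0.
have := conjugate_powR a0 (powR_ge0 b (p - 1)) p0 q0 pq.
rewrite -powRrM (_ : (p - 1) * (p / (p - 1)) = p)%R; last by field.
rewrite -(ler_pM2l p0) => young.
rewrite -(ler_pM2l p10).
have -> : ((p - 1) * (p / (p - 1) * (a `^ (p - 1) - b `^ (p - 1)) * a) =
  p * (a `^ p - a * b `^ (p - 1)))%R.
  by rewrite -(pS _ a0); field; rewrite p1n0.
have e2 : (p * (a `^ p / p + b `^ p / (p / (p - 1))) = a `^ p + (p - 1) * b `^ p)%R.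
  by field; rewrite pn0 p1n0.
rewrite e2 in young.
nra.
Qed.

(** For Y >= 0, layer_count * delta is Y rounded down to the grid of mesh delta
    and truncated at N * delta, except that a value on the grid goes to the
    point below it, the comparisons being strict. *)
Definition layer_count delta Y (N : nat) (w : T) : nat :=
  (\sum_(k < N) ((k.+1%:R * delta)%:E < Y w)%E)%N.

Lemma layer_count_full delta Y N w : (0 <= delta)%R ->
  (N%:R * delta)%:E < Y w -> layer_count delta Y N w = N.
Proof.
move=> delta0 NY; rewrite -[RHS](card_ord N) -sum1_card; apply: eq_bigr => k _.
by rewrite (le_lt_trans _ NY)// lee_fin ler_wpM2r// ler_nat.
Qed.

Lemma layer_count_approx delta Y N w : (0 <= delta)%R ->
  mine (Y w) (N%:R * delta)%:E <= ((layer_count delta Y N w).+1%:R * delta)%:E.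
Proof.
move=> delta0; have mono (m n : nat) : (m <= n)%N ->
    (m%:R * delta)%:E <= (n%:R * delta)%:E.
  by move=> mn; rewrite lee_fin ler_wpM2r// ler_nat.
elim: N => [|N IH]; first by rewrite ge_min mono ?orbT.
have [NY|YN] := ltP (N.+1%:R * delta)%:E (Y w).
  by rewrite (layer_count_full delta0 NY) mono.
have -> : layer_count delta Y N.+1 w = layer_count delta Y N w.
  by rewrite /layer_count big_ord_recr/= ltNge YN addn0.
move: IH; have [NY _|//] := ltP (N%:R * delta)%:E (Y w).
by rewrite (layer_count_full delta0 NY).
Qed.

(** The sets where Y exceeds the successive levels decrease, so counting them
    and then applying psi telescopes. This turns the integral of a function of
    the rounded Y into a sum over level sets. *)
Lemma layer_sum delta Y (psi : nat -> R) N w : (0 <= delta)%R -> psi 0%N = 0%R ->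
  psi (layer_count delta Y N w) = (\sum_(k < N)
    (psi k.+1 - psi k) * \1_[set w | ((k.+1%:R * delta)%:E < Y w)%E] w)%R.
Proof.
move=> delta0 psi0; elim: N => [|N IH].
  by rewrite /layer_count !big_ord0.
rewrite big_ord_recr/= -IH indicE.
have [NY|/le_gtF YN] := ltP (N.+1%:R * delta)%:E (Y w).
  have NY' : (N%:R * delta)%:E < Y w.
    by apply: le_lt_trans NY; rewrite lee_fin ler_wpM2r// ler_nat.
  by rewrite mem_set// (layer_count_full _ NY)// (layer_count_full _ NY')// mulr1 subrKC.
rewrite memNset/= ?YN// mulr0 addr0; congr psi.
by rewrite /layer_count big_ord_recr/= YN addn0.
Qed.

Lemma measurable_layer delta Y (psi : nat -> R) N : (0 <= delta)%R -> psi 0%N = 0%R ->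
  measurable_fun setT Y ->
  measurable_fun setT (fun w => psi (layer_count delta Y N w)).
Proof.
move=> delta0 psi0 mY.
under eq_fun do rewrite (layer_sum _ _ _ delta0 psi0).
apply: measurable_sum => k; apply: measurable_funM => //.
by apply: measurable_indic; exact: measurable_gt.
Qed.

Lemma integral_layer delta Y u (psi : nat -> R) N : (0 <= delta)%R -> psi 0%N = 0%R ->
  {homo psi : m n / (m <= n)%N >-> (m <= n)%R} ->
  measurable_fun setT Y -> measurable_fun setT u -> (forall w, 0 <= u w)%R ->
  \int[mu]_w (u w * psi (layer_count delta Y N w))%:E =
  \sum_(k < N) (psi k.+1 - psi k)%:E *
    \int[mu]_(w in [set w | (k.+1%:R * delta)%:E < Y w]) (u w)%:E.
Proof.
move=> delta0 psi0 ndpsi mY mu_ u0.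
pose A k := [set w | (k.+1%:R * delta)%:E < Y w].
have mA k : measurable (A k) by exact: measurable_gt.
have dpsi k : (0 <= psi k.+1 - psi k)%R by rewrite subr_ge0 ndpsi.
transitivity (\int[mu]_w \sum_(k < N) ((psi k.+1 - psi k)%:E * (u w * \1_(A k) w)%:E)).
  apply: eq_integral => w _; rewrite (layer_sum _ _ _ delta0 psi0) mulr_sumr -sumEFin.
  by apply: eq_bigr => k _; rewrite -EFinM mulrCA.
have m1 k : measurable_fun setT (fun w => (u w * \1_(A k) w)%:E).
  by apply/measurable_EFinP; apply: measurable_funM.
have u1 k w : 0 <= (u w * \1_(A k) w)%:E by rewrite lee_fin mulr_ge0.
rewrite ge0_integral_sum//.
- apply: eq_bigr => k _; rewrite ge0_integralZl_EFin//; congr (_ * _).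
  rewrite [RHS]integral_mkcond; apply: eq_integral => w _.
  rewrite patchE indicE; case: ifPn => _; first by rewrite mulr1.
  by rewrite mulr0.
- by move=> k; exact: measurable_funeM.
- by move=> k w _; rewrite mule_ge0// lee_fin.
Qed.

End layers.

(** * From weak type to the L_p norm *)

Section layer_norm.
Set Implicit Arguments. Unset Strict Implicit.
Local Open Scope ereal_scope.
Context d {T : measurableType d} {R : realType}.
Context (mu : {finite_measure set T -> \bar R}) (p : R) (p1 : (1 < p)%R).
Implicit Types (delta : R) (Y Z : T -> \bar R) (u : T -> R).

Let q := (p / (p - 1))%R.
Let p0 : (0 < p)%R := lt_trans ltr01 p1.
Let p10 : (0 < p - 1)%R. Proof. by rewrite subr_gt0. Qed.
Let q0 : (0 < q)%R. Proof. by rewrite divr_gt0. Qed.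
Let pq : (p^-1 + q^-1 = 1)%R.
Proof. by rewrite /q; field; rewrite !gt_eqF. Qed.

(** Slice by slice: on the level set at the grid point a, with b the previous
    grid point, (a^p - b^p) mu(Y > a) <= q (a^(p-1) - b^(p-1)) a mu(Y > a), and
    the weak-type hypothesis bounds a mu(Y > a). *)
Lemma integral_layer_pow delta Y u N : (0 < delta)%R -> measurable_fun setT Y ->
  measurable_fun setT u -> (forall w, 0 <= u w)%R -> weak_type mu Y (EFin \o u) ->
  \int[mu]_w (((layer_count delta Y N w)%:R * delta) `^ p)%:E <=
  q%:E * \int[mu]_w (u w * ((layer_count delta Y N w)%:R * delta) `^ (p - 1))%:E.
Proof.
move=> delta0 mY mf u0 wYu.
pose psi (r : R) (k : nat) := ((k%:R * delta) `^ r)%R.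
have psi0 r : (0 < r)%R -> psi r 0%N = 0%R.
  by move=> r0; rewrite /psi mul0r powR0// gt_eqF.
have ndpsi r : (0 < r)%R -> {homo psi r : m n / (m <= n)%N >-> (m <= n)%R}.
  move=> r0 m n mn; rewrite /psi ge0_ler_powR ?nnegrE ?mulr_ge0 ?(ltW r0) ?(ltW delta0)//.
  by rewrite ler_pM2r// ler_nat.
rewrite (@integral_layer _ _ _ mu delta Y u (psi (p - 1)%R))//; last 3 first.
- exact: ltW.
- exact: psi0.
- exact: ndpsi.
rewrite (eq_integral (fun w => (cst 1%R w * psi p (layer_count delta Y N w))%:E));
  last by move=> w _; rewrite mul1r.
rewrite (@integral_layer _ _ _ mu delta Y _ (psi p))//; last 3 first.
- exact: ltW.
- exact: psi0.
- exact: ndpsi.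
rewrite ge0_sume_distrr; last first.
  move=> k _; rewrite mule_ge0//.
    by rewrite lee_fin subr_ge0 ndpsi.
  by apply: integral_ge0 => w _; rewrite lee_fin.
apply: lee_sum => k _.
have mA : measurable [set w | (k.+1%:R * delta)%:E < Y w].
  exact: measurable_gt.
rewrite (_ : \int[mu]_(w in _) _ = mu [set w | (k.+1%:R * delta)%:E < Y w]);
  last by have := integral_cst mu mA 1; rewrite mul1e.
rewrite muleA -EFinM.
apply: (@le_trans _ _ ((q * (psi (p - 1)%R k.+1 - psi (p - 1)%R k))%:E *
    ((k.+1%:R * delta)%:E * mu [set w | (k.+1%:R * delta)%:E < Y w]))).
  rewrite muleA -EFinM; apply: lee_wpmul2r => //; rewrite lee_fin.
  apply: powR_increment => //; first by rewrite mulr_ge0// ltW.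
  by rewrite ler_pM2r// ler_nat.
apply: lee_wpmul2l.
  by rewrite lee_fin mulr_ge0 ?(ltW q0)// subr_ge0 ndpsi.
by apply: wYu; rewrite mulr_gt0.
Qed.

(** With D the rounded Y and I = \int D^p, Hoelder's inequality turns the previous
    bound into I <= q |u|_p I^(1/q). Since D is bounded, I is finite, so one may
    divide by I^(1/q). *)
Lemma Lnorm_layer_le delta Y u N : (0 < delta)%R -> measurable_fun setT Y ->
  measurable_fun setT u -> (forall w, 0 <= u w)%R -> weak_type mu Y (EFin \o u) ->
  'N[mu]_(p%:E)[(fun w => ((layer_count delta Y N w)%:R * delta)%:E)] <=
  q%:E * 'N[mu]_(p%:E)[EFin \o u].
Proof.
move=> delta0 mY mf u0 wYu.
have [uoo|uoo] := eqVneq ('N[mu]_(p%:E)[EFin \o u]) +oo.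
  by rewrite uoo gt0_muley ?leey// lte_fin.
pose D w := ((layer_count delta Y N w)%:R * delta)%R.
have D0 w : (0 <= D w)%R by rewrite mulr_ge0// ltW.
have mD : measurable_fun setT D.
  by apply: (measurable_layer (psi := fun k => (k%:R * delta)%R)); rewrite ?mul0r ?ltW.
pose Q w := (D w `^ (p - 1))%R.
have mQ : measurable_fun setT Q by exact: measurableT_comp (measurable_powR (p - 1)) _.
have DQ w : (D w `^ p = Q w `^ q)%R.
  by rewrite /Q -powRrM; congr powR; rewrite /q; field; rewrite gt_eqF.
pose I := \int[mu]_w (D w `^ p)%:E.
have I0 : 0 <= I by apply: integral_ge0 => w _; rewrite lee_fin powR_ge0.
have NpD : 'N[mu]_(p%:E)[(fun w => (D w)%:E)] = I `^ p^-1.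
  rewrite unlock; congr (_ `^ _); apply: eq_integral => w _.
  by rewrite gee0_abs ?lee_fin// poweR_EFin.
have NqQ : 'N[mu]_(q%:E)[EFin \o Q] = I `^ q^-1.
  rewrite unlock; congr (_ `^ _); apply: eq_integral => w _ /=.
  by rewrite ger0_norm ?powR_ge0// DQ.
have IQ : I <= q%:E * ('N[mu]_(p%:E)[EFin \o u] * I `^ q^-1).
  apply: le_trans (integral_layer_pow N delta0 mY mf u0 wYu) _.
  apply: lee_wpmul2l; first by rewrite lee_fin ltW.
  rewrite -NqQ; apply: le_trans (hoelder mu mf mQ p0 q0 pq).
  rewrite Lnorm1; apply: ge0_le_integral => //.
  - by move=> w _; rewrite lee_fin mulr_ge0// powR_ge0.
  - by apply/measurable_EFinP; exact: measurable_funM.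
  - apply/measurableT_comp => //; apply/measurable_EFinP; exact: measurable_funM.
  - by move=> w _; rewrite lee_fin/= ler_norm.
have Ifin : I \is a fin_num.
  rewrite ge0_fin_numE//.
  apply: (@le_lt_trans _ _ (\int[mu]_w ((N%:R * delta) `^ p)%:E)).
    apply: ge0_le_integral => //.
    - by move=> w _; rewrite lee_fin powR_ge0.
    - apply/measurable_EFinP; exact: measurableT_comp (measurable_powR p) _.
    - move=> w _; rewrite lee_fin ge0_ler_powR ?nnegrE ?mulr_ge0 ?(ltW p0) ?(ltW delta0)//.
      rewrite ler_pM2r// ler_nat -[leqRHS](card_ord N) -sum1_card.
      by apply: leq_sum => k _; exact: leq_b1.
  rewrite integral_cst// ltey_eq fin_numM// fin_num_measure//.
have := Lnorm_ge0 mu p%:E (EFin \o u).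
move: IQ uoo; rewrite -/(D _) NpD.
move: I0 Ifin; case: I {NpD NqQ} => // i; rewrite lee_fin => i0 _.
case: ('N[mu]_(p%:E)[EFin \o u]) => // c.
rewrite !poweR_EFin -!EFinM !lee_fin => ile _ c0.
have [->|in0] := eqVneq i 0%R.
  by rewrite powR0 ?invr_eq0 ?gt_eqF// mulr_ge0// ltW.
have igt : (0 < i)%R by rewrite lt_neqAle eq_sym in0.
have iq : (0 < i `^ q^-1)%R by rewrite powR_gt0.
rewrite -(ler_pM2r iq) -powRD ?pq ?powRr1//; last by rewrite in0 implybT.
by rewrite -mulrA.
Qed.

End layer_norm.

Section strong_type_Lnorm.
Set Implicit Arguments. Unset Strict Implicit.
Local Open Scope ereal_scope.
Context d {T : measurableType d} {R : realType}.
Context (mu : {finite_measure set T -> \bar R}).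
Implicit Types (p delta : R) (Y Z : T -> \bar R) (u : T -> R).

Lemma Lnorm_le p Y Z : (0 < p)%R -> measurable_fun setT Y -> measurable_fun setT Z ->
  (forall w, 0 <= Y w <= Z w) -> 'N[mu]_(p%:E)[Y] <= 'N[mu]_(p%:E)[Z].
Proof.
move=> p0 mY mZ YZ; rewrite unlock.
have mp (V : T -> \bar R) : measurable_fun setT V ->
    measurable_fun setT (fun w => `|V w| `^ p).
  move=> mV; apply: (@measurableT_comp _ _ _ _ _ _ (fun x => x `^ p)).
    exact: measurable_poweR.
  exact: measurableT_comp.
apply: gt0_ler_poweR; first by rewrite invr_ge0 ltW.
- by rewrite in_itv/= leey andbT integral_ge0// => w _; exact: poweR_ge0.
- by rewrite in_itv/= leey andbT integral_ge0// => w _; exact: poweR_ge0.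
apply: ge0_le_integral => //.
- by move=> w _; exact: poweR_ge0.
- exact: mp.
- exact: mp.
move=> w _; have /andP[Y0 YZw] := YZ w.
apply: gt0_ler_poweR; rewrite ?in_itv/= ?leey ?andbT ?(ltW p0)//.
by rewrite (gee0_abs Y0) (gee0_abs (le_trans Y0 YZw)).
Qed.

Lemma Lnorm_cst_EFin p delta : (0 < p)%R -> (0 <= delta)%R ->
  'N[mu]_(p%:E)[cst delta%:E] = delta%:E * mu setT `^ p^-1.
Proof.
move=> p0 delta0; rewrite unlock.
rewrite (eq_integral (cst (delta `^ p)%:E)); last first.
  by move=> w _ /=; rewrite ger0_norm.
rewrite integral_cst// poweRM// ?lee_fin ?powR_ge0//.
by rewrite -poweR_EFin -poweRrM mulfV ?gt_eqF// poweRe1.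
Qed.

(** The truncation of Y at K exceeds the rounded Y by at most the mesh delta,
    whose norm is delta mu(T)^(1/p); the mesh is chosen to make it at most e. *)
Lemma Lnorm_truncation_le p Y u K e : (1 < p)%R -> measurable_fun setT Y ->
  (forall w, 0 <= Y w) -> measurable_fun setT u -> (forall w, 0 <= u w)%R ->
  weak_type mu Y (EFin \o u) -> (0 <= K)%R -> (0 < e)%R ->
  'N[mu]_(p%:E)[(fun w => mine (Y w) K%:E)] <=
  (p / (p - 1))%:E * 'N[mu]_(p%:E)[EFin \o u] + e%:E.
Proof.
move=> p1 mY Y0 mf u0 wYu K0 e0.
have p0 : (0 < p)%R by exact: lt_trans p1.
have [c c0 cE] : exists2 c : R, (0 <= c)%R & mu setT `^ p^-1 = c%:E.
  exists (fine (mu setT `^ p^-1)); first by rewrite fine_ge0// poweR_ge0.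
  by rewrite fineK// fin_num_poweR// fin_num_measure.
pose delta := (e / (c + 1))%R.
have c1 : (0 < c + 1)%R by rewrite ltr_wpDl.
have delta0 : (0 < delta)%R by rewrite divr_gt0.
pose N := Num.bound (K / delta).
have KN : (K <= N%:R * delta)%R.
  by rewrite -ler_pdivrMr// ltW// archi_boundP// divr_ge0// ltW.
pose D w := ((layer_count delta Y N w)%:R * delta)%R.
have mD : measurable_fun setT D.
  by apply: (measurable_layer (psi := fun k => (k%:R * delta)%R)); rewrite ?mul0r ?ltW.
apply: (@le_trans _ _ ('N[mu]_(p%:E)[EFin \o (D \+ cst delta)%R])).
  apply: Lnorm_le => //.
  - exact: measurable_mine.
  - by apply/measurable_EFinP; exact: measurable_funD.
  move=> w; rewrite le_min Y0 lee_fin K0/=.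
  apply: (@le_trans _ _ (mine (Y w) (N%:R * delta)%:E)).
    by rewrite le_min !ge_min lexx/= lee_fin KN orbT.
  apply: le_trans (layer_count_approx _ _ _ (ltW delta0)) _.
  by rewrite lee_fin /D -natr1 mulrDl mul1r.
apply: le_trans (eminkowski _ _ _ _) _ => //.
  by rewrite lee_fin ltW.
apply: leeD; first exact: Lnorm_layer_le.
rewrite (Lnorm_cst_EFin p0 (ltW delta0)) cE -EFinM lee_fin /delta.
by rewrite mulrAC ler_pdivrMr// ler_pM2l// lerDl.
Qed.

Lemma poweR_truncation_cvg p (y : \bar R) : (1 <= p)%R -> 0 <= y ->
  mine y n%:R%:E `^ p @[n --> \oo] --> y `^ p.
Proof.
move=> p1; case: y => [r r0|_|//].
  apply: cvg_near_cst; near=> n; rewrite min_l// lee_fin.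
  near: n; exact: nbhs_infty_ger.
rewrite poweRyr ?gt_eqF ?(lt_le_trans _ p1)//; apply/cvgeyPge => A; near=> n.
rewrite min_r ?leey// poweR_EFin lee_fin (@le_trans _ _ n%:R)//.
  near: n; exact: nbhs_infty_ger.
rewrite -[leLHS]powRr1// ler_powR//.
near: n; exact: nbhs_infty_ger.
Unshelve. all: by end_near. Qed.

Lemma weak_type_Lnorm_real p Y u : (1 < p)%R -> measurable_fun setT Y ->
  (forall w, 0 <= Y w) -> measurable_fun setT u -> (forall w, 0 <= u w)%R ->
  weak_type mu Y (EFin \o u) ->
  'N[mu]_(p%:E)[Y] <= (p / (p - 1))%:E * 'N[mu]_(p%:E)[EFin \o u].
Proof.
move=> p1 mY Y0 mf u0 wYu; set B := leRHS.
have p0 : (0 < p)%R by exact: lt_trans p1.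
have B0 : 0 <= B.
  apply: mule_ge0; last exact: Lnorm_ge0.
  by rewrite lee_fin divr_ge0 ?subr_ge0 ?(ltW p0) ?(ltW p1).
pose f n w := mine (Y w) n%:R%:E `^ p.
have f0 n w : 0 <= f n w by exact: poweR_ge0.
have mfn n : measurable_fun setT (f n).
  apply: (@measurableT_comp _ _ _ _ _ _ (fun x => x `^ p)).
    exact: measurable_poweR.
  exact: measurable_mine.
have min0 n w : 0 <= mine (Y w) n%:R%:E by rewrite le_min Y0 lee_fin/=.
have ndf w : nondecreasing_seq (f ^~ w).
  move=> m n mn; apply: gt0_ler_poweR; rewrite ?in_itv/= ?leey ?andbT ?(ltW p0)//.
  by rewrite le_min !ge_min lexx/= lee_fin ler_nat mn orbT.
have fB n : \int[mu]_w f n w <= B `^ p.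
  have -> : \int[mu]_w f n w = 'N[mu]_(p%:E)[(fun w => mine (Y w) n%:R%:E)] `^ p.
    rewrite poweR_Lnorm ?gt_eqF//; apply: eq_integral => w _.
    by rewrite gee0_abs.
  apply: gt0_ler_poweR; rewrite ?in_itv/= ?leey ?andbT ?(ltW p0) ?Lnorm_ge0//.
  by apply/lee_addgt0Pr => e e0; exact: Lnorm_truncation_le.
have YB : \int[mu]_w `|Y w| `^ p <= B `^ p.
  have fY : \int[mu]_w f n w @[n --> \oo] --> \int[mu]_w `|Y w| `^ p.
    rewrite [X in _ --> X](_ : _ = \int[mu]_w limn (f ^~ w)).
      exact: cvg_monotone_convergence.
    apply: eq_integral => w _; rewrite gee0_abs//; apply/esym/cvg_lim => //.
    exact: poweR_truncation_cvg (ltW p1) (Y0 w).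
  by apply: (cvge_to_le fY); exact: nearW.
rewrite -[leRHS](@poweRe1 _ B)// -(@mulfV _ p) ?gt_eqF// poweRrM unlock.
apply: gt0_ler_poweR; rewrite ?in_itv/= ?leey ?andbT ?invr_ge0 ?(ltW p0) ?poweR_ge0//.
by apply: integral_ge0 => w _; exact: poweR_ge0.
Qed.

(** An integrable Z is almost everywhere finite, so it may be replaced by a real
    function without changing its integrals. *)
Theorem weak_type_Lnorm p Y Z : (1 < p)%R -> measurable_fun setT Y ->
  (forall w, 0 <= Y w) -> mu.-integrable setT Z -> (forall w, 0 <= Z w) ->
  weak_type mu Y Z ->
  'N[mu]_(p%:E)[Y] <= (p / (p - 1))%:E * 'N[mu]_(p%:E)[Z].
Proof.
move=> p1 mY Y0 iZ Z0 wYZ.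
have mZ := measurable_int mu iZ.
have p0 : (0 < p)%R by exact: lt_trans p1.
have mfZ : measurable_fun setT (fine \o Z) by exact: measurableT_comp.
apply: (@le_trans _ _ ((p / (p - 1))%:E * 'N[mu]_(p%:E)[EFin \o (fine \o Z)])).
  apply: weak_type_Lnorm_real => //; first by move=> w; exact: fine_ge0.
  move=> l l0; apply: le_trans (wYZ l l0) _.
  have mA : measurable [set w | l%:E < Y w] by exact: measurable_gt.
  rewrite le_eqVlt; apply/orP; left; apply/eqP; apply: ae_eq_integral => //.
  - exact: measurable_funTS.
  - by apply: measurable_funTS; exact/measurable_EFinP.
  have := integrable_ae measurableT iZ; apply: filterS => w /(_ I) Zw _ /=.
  by rewrite fineK.
apply: lee_wpmul2l; first by rewrite lee_fin divr_ge0// ?subr_ge0 ltW.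
apply: Lnorm_le => //; first exact/measurable_EFinP.
move=> w; rewrite /= lee_fin fine_ge0//=.
by case: (Z w) (Z0 w) => //= _; rewrite lee_fin.
Qed.

End strong_type_Lnorm.

(** * Slicing along a geometric grid *)

Section weight.
Set Implicit Arguments. Unset Strict Implicit.
Local Open Scope ereal_scope.
Context {R : realType}.
Implicit Types (m : nat) (x y : \bar R) (r : R).

Lemma LlogL_weight_EFin m r :
  LlogL_weight m r%:E = (r * ln (Num.max 1 r) ^+ m)%:E.
Proof.
rewrite /LlogL_weight EFinM EFin_expe -lne_EFin; last by rewrite lt_max ltr01.
by rewrite EFin_max.
Qed.

Lemma LlogL_weight_pinfty m : LlogL_weight m +oo = +oo :> \bar R.
Proof.
rewrite /LlogL_weight (max_r (leey _)) /=; elim: m => [|m IH]; first by rewrite mule1.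
by rewrite expeS muleA mulyy.
Qed.

Lemma lne_max1_ge0 x : 0 <= lne (maxe 1 x).
Proof. by rewrite lne_ge0 le_max lexx. Qed.

Lemma LlogL_weight_ge0 m x : 0 <= x -> 0 <= LlogL_weight m x.
Proof. by move=> x0; rewrite mule_ge0// expe_ge0// lne_max1_ge0. Qed.

Lemma LlogL_weight_le m x y : 0 <= x -> x <= y ->
  LlogL_weight m x <= LlogL_weight m y.
Proof.
case: y => [s| |]; last 2 first.
- by move=> _ _; rewrite LlogL_weight_pinfty leey.
- by move=> /le_trans /[apply]; rewrite leeNy_eq.
case: x => [r| |]//; rewrite !lee_fin => r0 rs.
rewrite !LlogL_weight_EFin lee_fin ler_pM ?exprn_ge0 ?ln_ge0 ?le_max ?lexx//.
apply: lerXn2r; rewrite ?nnegrE ?ln_ge0 ?le_max ?lexx//.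
rewrite ler_ln ?posrE ?lt_max ?ltr01//.
by rewrite ge_max !le_max lexx rs orbT.
Qed.

(** On the values of max(1, Y) the extended logarithm is the real one extended
    by +oo at +oo, and that extension is measurable. *)
Lemma measurable_LlogL_weight d (T : measurableType d) m (Y : T -> \bar R) :
  measurable_fun setT Y -> measurable_fun setT (fun w => LlogL_weight m (Y w)).
Proof.
move=> mY; have mL : measurable_fun setT (fun w => lne (maxe 1 (Y w))).
  rewrite (_ : (fun w => _) = er_map (@ln R) \o (fun w => maxe 1 (Y w))).
    apply: measurableT_comp; first exact: measurable_er_map.
    exact: measurable_maxe.
  apply/funext => w /=; case: (Y w) => [r| |].
  - by rewrite -EFin_max lne_EFin// lt_max ltr01.
  - by rewrite (max_r (leey _)).
  - by rewrite (max_l (leNye _)) lne1/= ln1.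
apply: emeasurable_funM => //; elim: m => [|m IH].
  by under eq_fun do rewrite expe0; exact: measurable_cst.
by under eq_fun do rewrite expeS; exact: emeasurable_funM.
Qed.

Lemma expR1_ge2 : (2 <= expR 1 :> R)%R.
Proof. by have := expR_ge1Dx (1 : R); rewrite -[(1 + 1)%R]/(2%:R). Qed.

Definition exp_level (k : nat) : R := expR k%:R.

Lemma exp_level_ge1 k : (1 <= exp_level k)%R.
Proof. by rewrite /exp_level -expR0 ler_expR. Qed.

(** Let n be the integral part of log (max 1 y). If n > 0, the term k = n - 1
    alone is e^(n+1) (n+1)^m, which exceeds the weight; the term k = n would be
    of no use, since y > e^(n-1) holds but y > e^n may fail. If n = 0 the weight
    is at most e. *)
Lemma LlogL_weight_le_series m y : 0 <= y ->
  LlogL_weight m y <= (expR 1)%:E + \sum_(k <oo)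
    (expR 1 ^+ 2 * exp_level k * (k.+2)%:R ^+ m)%:E * ((exp_level k)%:E < y)%E%:R%:E.
Proof.
pose c k : R := (expR 1 ^+ 2 * exp_level k * (k.+2)%:R ^+ m)%R.
have c0 k : (0 <= c k)%R by rewrite !mulr_ge0// expR_ge0.
have t0 y' k : 0 <= (c k)%:E * ((exp_level k)%:E < y')%E%:R%:E.
  by rewrite mule_ge0// lee_fin.
case: y => [r| |]// r0.
  have s0 : 0 <= \sum_(k <oo) (c k)%:E * ((exp_level k)%:E < r%:E)%E%:R%:E.
    by apply: nneseries_ge0 => k _ _; exact: t0.
  rewrite LlogL_weight_EFin; pose L := ln (Num.max 1%R r).
  have L0 : (0 <= L)%R by rewrite ln_ge0// le_max lexx.
  have rL : (r <= expR L)%R.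
    by rewrite lnK ?posrE ?lt_max ?ltr01// le_max lexx orbT.
  have [n LE] : exists n, (n%:R <= L < n.+1%:R)%R.
    by exists (Num.truncn L); exact: truncn_itv.
  case: n LE => [|n] /andP[nL Ln].
    apply: (@le_trans _ _ (expR 1)%:E); last by rewrite leeDl.
    rewrite lee_fin (@le_trans _ _ (r * 1)%R)//.
      by rewrite ler_wpM2l// exprn_ile1// ltW.
    by rewrite mulr1 (le_trans rL)// ler_expR ltW.
  have rn : (exp_level n < r)%R.
    have r1 : (1 < r)%R.
      rewrite ltNge; apply/negP => r1.
      have : (L <= 0)%R by rewrite /L max_l// ln1.
      by rewrite leNgt (lt_le_trans _ nL).
    rewrite /exp_level -[ltRHS]lnK ?posrE ?(lt_trans ltr01)// ltr_expR.
    move: nL; rewrite /L max_r ?(ltW r1)//; apply: lt_le_trans.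
    by rewrite ltr_nat.
  apply: (@le_trans _ _ (\sum_(0 <= k < n.+1) (c k)%:E * ((exp_level k)%:E < r%:E)%E%:R%:E)).
    rewrite big_nat_recr//= lte_fin rn mule1.
    apply: (@le_trans _ _ (c n)%:E); last first.
      by rewrite leeDr// sume_ge0// => k _; exact: t0.
    rewrite lee_fin ler_pM ?exprn_ge0//.
      apply: le_trans rL _.
      rewrite /exp_level -expRM_natl mulr1 -expRD ler_expR (le_trans (ltW Ln))//.
      by rewrite -natrD.
    apply: lerXn2r; rewrite ?nnegrE// ltW//.
  apply: (@le_trans _ _ (\sum_(k <oo) (c k)%:E * ((exp_level k)%:E < r%:E)%E%:R%:E)).
    by apply: nneseries_lim_ge => k _ _; exact: t0.
  by rewrite leeDr// lee_fin expR_ge0.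
(* At y = +oo every term is at least 1. *)
rewrite LlogL_weight_pinfty leye_eq; apply/eqP/eqyP => A A0.
set S := \sum_(k <oo) _.
pose N := Num.bound A.
apply: (@le_trans _ _ S); last by rewrite leeDr// lee_fin expR_ge0.
apply: (@le_trans _ _ (\sum_(0 <= k < N) (c k)%:E * ((exp_level k)%:E < +oo)%E%:R%:E)); last first.
  by apply: nneseries_lim_ge => k _ _; exact: t0.
apply: (@le_trans _ _ (\sum_(0 <= k < N) 1)).
  rewrite sumEFin big_const_nat subn0 iter_addr addr0 lee_fin.
  by apply/ltW/archi_boundP/ltW.
apply: lee_sum => k _; rewrite ltry mule1 lee_fin -[leLHS]mulr1 ler_pM//.
  rewrite -[leLHS]mulr1 ler_pM ?exp_level_ge1//.
  by rewrite exprn_ege1// (le_trans _ expR1_ge2)// ler1n.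
by rewrite exprn_ege1// ler1n.
Qed.

(** At most x + 1 terms are nonzero, and each of them is at most (x + 2)^m. *)
Lemma sum_count_le m (x : R) N : (0 <= x)%R ->
  (\sum_(0 <= k < N) (k.+2)%:R ^+ m * (k%:R < x)%R%:R <= (x + 2) ^+ m.+1)%R.
Proof.
move=> x0; apply: (@le_trans _ _ (\sum_(0 <= k < N) (x + 2) ^+ m * (k%:R < x)%R%:R)%R).
  apply: ler_sum => k _; case: ltP => kx; last by rewrite !mulr0.
  rewrite !mulr1; apply: lerXn2r; rewrite ?nnegrE ?ler0n ?addr_ge0//.
  by rewrite (_ : k.+2%:R = k%:R + 2)%R ?lerD2r ?(ltW kx)// -natrD addn2.
rewrite -mulr_sumr exprSr ler_wpM2l ?exprn_ge0 ?addr_ge0//.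
suff [_ h] : (\sum_(0 <= k < N) (k%:R < x)%R%:R <= N%:R :> R)%R /\
    (\sum_(0 <= k < N) (k%:R < x)%R%:R <= x + 1 :> R)%R.
  by rewrite (le_trans h)// lerD2l ler1n.
elim: N => [|N [IH1 IH2]]; first by rewrite big_geq// addr_ge0.
rewrite big_nat_recr//=; case: ltP => Nx.
  split; first by rewrite -[N.+1]addn1 natrD lerD2r.
  by rewrite lerD2r (le_trans IH1)// ltW.
by rewrite addr0; split => //; rewrite (le_trans IH1)// ler_nat.
Qed.

(** As 2 <= e, the condition e^k / 2 < y forces k < L + 1 with
    L = log (max 1 y), so the sum is at most y (L + 3)^(m+1). *)
Lemma series_le_LlogL_weight m y : 0 <= y ->
  \sum_(k <oo) ((k.+2)%:R ^+ m)%:E * (y * ((exp_level k / 2)%:E < y)%E%:R%:E) <=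
  (4 ^+ m.+1)%:E * (y + LlogL_weight m.+1 y).
Proof.
case: y => [r| |]// r0; last first.
  by rewrite LlogL_weight_pinfty gt0_muley ?leey// lte_fin exprn_gt0.
pose L := ln (Num.max 1%R r).
have L0 : (0 <= L)%R by rewrite ln_ge0// le_max lexx.
have rL : (r <= expR L)%R.
  by rewrite lnK ?posrE ?lt_max ?ltr01// le_max lexx orbT.
apply: lime_le.
  by apply: is_cvg_nneseries => k _ _; rewrite !mule_ge0// lee_fin// exprn_ge0.
apply: nearW => N.
have -> : \sum_(0 <= k < N) ((k.+2)%:R ^+ m)%:E *
    (r%:E * ((exp_level k / 2)%:E < r%:E)%E%:R%:E) =
  (r * \sum_(0 <= k < N) (k.+2)%:R ^+ m * (exp_level k / 2 < r)%R%:R)%:E.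
  rewrite mulr_sumr -sumEFin; apply: eq_bigr => k _.
  by rewrite -!EFinM lte_fin mulrCA.
rewrite LlogL_weight_EFin -EFinD -EFinM lee_fin -/L.
rewrite (_ : r + r * L ^+ m.+1 = r * (1 + L ^+ m.+1))%R; last by ring.
rewrite mulrCA ler_wpM2l//.
apply: (@le_trans _ _ (\sum_(0 <= k < N) (k.+2)%:R ^+ m * (k%:R < L + 1)%R%:R)%R).
  apply: ler_sum => k _; rewrite ler_wpM2l ?exprn_ge0// ler_nat.
  case: (ltP (exp_level k / 2)%R r) => //= kr; rewrite lt0b.
  rewrite -ltr_expR expRD; move: kr; rewrite ltr_pdivrMr// => /lt_le_trans; apply.
  by rewrite ler_pM// expR1_ge2.
apply: le_trans (sum_count_le _ _ _) _; first by rewrite addr_ge0.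
have [L1|/ltW L1] := leP L 1%R.
  rewrite -[leLHS]mulr1 ler_pM ?exprn_ge0 ?addr_ge0//.
    apply: lerXn2r; rewrite ?nnegrE ?addr_ge0//; lra.
  by rewrite lerDl exprn_ge0.
apply: (@le_trans _ _ ((4 * L) ^+ m.+1)%R).
  by apply: lerXn2r; rewrite ?nnegrE ?addr_ge0 ?mulr_ge0//; lra.
by rewrite exprMn ler_wpM2l ?exprn_ge0// lerDr.
Qed.

End weight.

(** * From weak type to the Zygmund classes *)

Section zygmund_type.
Set Implicit Arguments. Unset Strict Implicit.
Local Open Scope ereal_scope.
Context d {T : measurableType d} {R : realType}.
Context (mu : {finite_measure set T -> \bar R}).
Implicit Types (l : R) (Y Z : T -> \bar R) (A B : set T).

Lemma integral_restrict_indic Z B :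
  \int[mu]_(w in B) Z w = \int[mu]_w (Z w * (\1_B w)%:E).
Proof.
rewrite integral_mkcond; apply: eq_integral => w _.
by rewrite patchE indicE; case: ifPn => _; rewrite ?mule1 ?mule0.
Qed.

(** On the set Y > l, the part of Z below l / 2 contributes at most
    (l / 2) mu(Y > l), which is half of the left-hand side of the weak-type
    inequality. The set of integration is now described by Z alone, which
    makes the sum over the levels a function of Z. *)
Lemma weak_type_half Y Z l : measurable_fun setT Y -> measurable_fun setT Z ->
  (forall w, 0 <= Z w) -> weak_type mu Y Z -> (0 < l)%R ->
  (l / 2)%:E * mu [set w | l%:E < Y w] <=
  \int[mu]_(w in [set w | (l / 2)%:E < Z w]) Z w.
Proof.
move=> mY mZ Z0 wYZ l0.
set A := [set w | l%:E < Y w]; set B := [set w | (l / 2)%:E < Z w].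
have mA : measurable A by exact: measurable_gt.
have mB : measurable B by exact: measurable_gt.
have mZB : measurable_fun setT (fun w => Z w * (\1_B w)%:E).
  by apply: emeasurable_funM => //; apply/measurable_EFinP.
have ZB0 w : 0 <= Z w * (\1_B w)%:E by rewrite mule_ge0// lee_fin.
have l2 : (0 <= l / 2)%R by rewrite divr_ge0// ltW.
have [c c0 cE] := finite_measure_EFin mu mA.
suff : l%:E * mu A <= \int[mu]_(w in B) Z w + (l / 2)%:E * mu A.
  rewrite cE -!EFinM -leeBlDr// -EFinB; congr (_%:E <= _).
  by rewrite -mulrBl {1}(splitr l) addrK.
apply: le_trans (wYZ l l0) _; rewrite -/A.
apply: (@le_trans _ _ (\int[mu]_(w in A) (Z w * (\1_B w)%:E + (l / 2)%:E))).
  apply: ge0_le_integral => //.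
  - exact: measurable_funTS.
  - by apply: measurable_funTS; exact: emeasurable_funD.
  move=> w _; rewrite indicE; have [BZ|ZB] := boolP (w \in B).
    by rewrite mule1 leeDl// lee_fin.
  by rewrite mule0 add0e leNgt; apply: contra ZB => BZ; apply/mem_set.
rewrite ge0_integralD//; last exact: measurable_funTS.
rewrite integral_cst// leeD2r// integral_restrict_indic.
exact: ge0_subset_integral.
Qed.

(** Slicing Y at the levels e^k, the weight of order m charges the level set at
    e^k with about e^k k^m, hence with k^m times an integral of Z over the set
    where Z > e^k / 2. For a given value z of Z these sets occur for about log z
    values of k, and the sum of k^m over them is about (log z)^(m+1). *)
Theorem weak_type_LlogL m Y Z : measurable_fun setT Y -> (forall w, 0 <= Y w) ->
  measurable_fun setT Z -> (forall w, 0 <= Z w) -> weak_type mu Y Z ->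
  \int[mu]_w Z w < +oo -> \int[mu]_w LlogL_weight m.+1 (Z w) < +oo ->
  \int[mu]_w LlogL_weight m (Y w) < +oo.
Proof.
move=> mY Y0 mZ Z0 wYZ iZ iwZ.
pose A k := [set w | (exp_level k : R)%:E < Y w].
pose B k := [set w | (exp_level k / 2 : R)%:E < Z w].
have mA k : measurable (A k) by exact: measurable_gt.
have mB k : measurable (B k) by exact: measurable_gt.
have lev0 k : (0 < exp_level k :> R)%R by exact: expR_gt0.
pose a k : R := (expR 1 ^+ 2 * exp_level k * (k.+2)%:R ^+ m)%R.
pose b k : R := ((k.+2)%:R ^+ m)%R.
have a0 k : (0 <= a k)%R by rewrite !mulr_ge0// ?expR_ge0// ltW.
have b0 k : (0 <= b k)%R by rewrite exprn_ge0.
have mIA k : measurable_fun setT (fun w => (a k)%:E * (\1_(A k) w)%:E).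
  by apply: measurable_funeM; exact/measurable_EFinP.
have IA0 k w : 0 <= (a k)%:E * (\1_(A k) w)%:E by rewrite mule_ge0// lee_fin.
have mIB k : measurable_fun setT (fun w => Z w * (\1_(B k) w)%:E).
  by apply: emeasurable_funM => //; exact/measurable_EFinP.
have IB0 k w : 0 <= Z w * (\1_(B k) w)%:E by rewrite mule_ge0// lee_fin.
pose C : R := (2 * expR 1 ^+ 2)%R.
have C0 : (0 <= C)%R by rewrite mulr_ge0// exprn_ge0// expR_ge0.
have AB k : (a k)%:E * mu (A k) <= C%:E * ((b k)%:E * \int[mu]_(w in B k) Z w).
  have -> : a k = (C * b k * (exp_level k / 2))%R.
    by rewrite /a /C /b; field.
  rewrite [in leLHS]EFinM -muleA [leRHS]muleA -EFinM; apply: lee_wpmul2l.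
    by rewrite lee_fin mulr_ge0.
  exact: weak_type_half.
apply: (@le_lt_trans _ _ (\int[mu]_w ((expR 1)%:E +
    \sum_(k <oo) (a k)%:E * (\1_(A k) w)%:E))).
  apply: ge0_le_integral => //.
  - by move=> w _; exact: LlogL_weight_ge0.
  - exact: measurable_LlogL_weight.
  - apply: emeasurable_funD => //; exact: ge0_emeasurable_sum.
  move=> w _; apply: le_trans (LlogL_weight_le_series m (Y0 w)) _.
  rewrite leeD2l//; apply: lee_nneseries => k _.
    by move=> _; apply: mule_ge0; rewrite lee_fin ?a0.
  by rewrite indicE mem_setE.
rewrite ge0_integralD//; last 2 first.
- by move=> w _; apply: nneseries_ge0 => k _ _.
- exact: ge0_emeasurable_sum.
rewrite integral_cst// lte_add_pinfty//.
  by rewrite ltey_eq fin_numM// fin_num_measure.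
rewrite integral_nneseries//.
apply: (@le_lt_trans _ _ (\sum_(k <oo) C%:E * ((b k)%:E * \int[mu]_(w in B k) Z w))).
  apply: lee_nneseries => k _; first by move=> _; exact: integral_ge0.
  rewrite ge0_integralZl_EFin//; last exact/measurable_EFinP.
  by rewrite integral_indic// setIT.
have iB k : \int[mu]_(w in B k) Z w = \int[mu]_w (Z w * (\1_(B k) w)%:E).
  exact: integral_restrict_indic.
rewrite nneseriesZl; last first.
  by move=> k _; rewrite mule_ge0 ?lee_fin// integral_ge0.
rewrite lte_mul_pinfty//.
apply: (@le_lt_trans _ _ (\int[mu]_w
    ((4 ^+ m.+1)%:E * (Z w + LlogL_weight m.+1 (Z w))))).
  under eq_eseriesr => k _ do rewrite iB -ge0_integralZl_EFin//.
  rewrite -integral_nneseries//; last 2 first.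
  - by move=> k; exact: measurable_funeM.
  - by move=> k w _; rewrite mule_ge0// lee_fin.
  apply: ge0_le_integral => //.
  - by move=> w _; apply: nneseries_ge0 => k _ _; rewrite mule_ge0// lee_fin.
  - apply: ge0_emeasurable_sum => //.
      by move=> k w _ _; rewrite mule_ge0// lee_fin.
    by move=> k _; exact: measurable_funeM.
  - apply: measurable_funeM; apply: emeasurable_funD => //.
    exact: measurable_LlogL_weight.
  move=> w _; apply: le_trans (series_le_LlogL_weight m (Z0 w)).
  apply: lee_nneseries => k _; first by move=> _; rewrite mule_ge0// lee_fin.
  by rewrite indicE mem_setE.
have mwZ : measurable_fun setT (fun w => LlogL_weight m.+1 (Z w)).
  exact: measurable_LlogL_weight.
have wZ0 w : 0 <= LlogL_weight m.+1 (Z w) by exact: LlogL_weight_ge0.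
rewrite ge0_integralZl_EFin//; last 2 first.
- by move=> w _; exact: adde_ge0.
- exact: emeasurable_funD.
rewrite lte_mul_pinfty// ?lee_fin ?exprn_ge0// ge0_integralD//.
by rewrite lte_add_pinfty.
Qed.

End zygmund_type.

(** * The double supremum *)

Section suprema.
Set Implicit Arguments. Unset Strict Implicit.
Local Open Scope ereal_scope.
Context d {T : measurableType d} {R : realType} {X : normedModType R}.

Lemma measurable_ereal_sup (I : countType) (f : I -> T -> \bar R) :
  (forall i, measurable_fun setT (f i)) ->
  measurable_fun setT (fun w => ereal_sup (range (f ^~ w))).
Proof.
move=> mf _; apply: (measurability _ (ErealGenOInfty.measurableE R)) => //.
move=> _ [_ [r ->] <-]; rewrite setTI.
rewrite (_ : _ @^-1` _ = \bigcup_i [set w | r%:E < f i w]).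
  by apply: countable_bigcupT_measurable => // i; exact: measurable_gt.
apply/seteqP; split=> [w|w [i _ /= ri]] /=; rewrite in_itv/= andbT.
  by move=> /ereal_sup_gt[_ [i _ <-]]; exists i.
by apply: lt_le_trans ri _; apply: ereal_sup_ubound; exists i.
Qed.

Lemma measurable_sup_norm (I : countType) (h : I -> T -> X) :
  (forall i, strongly_measurable measurable (h i)) ->
  measurable_fun setT (sup_norm h).
Proof.
move=> sh; apply: measurable_ereal_sup => i.
have := strongly_measurable_norm 0%R (sh i).
by under eq_fun do rewrite subr0.
Qed.

Lemma sup_norm_ge0 (I : pointedType) (h : I -> T -> X) w : 0 <= sup_norm h w.
Proof.
apply: (@le_trans _ _ `|h point w|%:E); first by rewrite lee_fin.
by apply: ereal_sup_ubound; exists point.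
Qed.

Lemma iter_generated_operator (tau : T -> T) (f : T -> X) i w :
  iter i (generated_operator tau) f w = f (iter i tau w).
Proof.
by elim: i w => //= i IH w; rewrite /generated_operator/= IH -iterSr.
Qed.

Lemma sup_norm_ergodic_average_le (tau : T -> T) (f : T -> X) w :
  sup_norm (fun n : nat => ergodic_average tau n.+1 f) w <=
  ereal_sup (range (fun n => (n.+1%:R^-1 * \sum_(i < n.+1) `|f (iter i tau w)|)%R%:E)).
Proof.
apply: ge_ereal_sup => _ [n _ <-].
apply: (@le_trans _ _ (n.+1%:R^-1 * \sum_(i < n.+1) `|f (iter i tau w)|)%R%:E).
  rewrite lee_fin /ergodic_average normrZ ger0_norm ?invr_ge0// ler_wpM2l ?invr_ge0//.
  apply: le_trans (ler_norm_sum _ _ _) _; apply: ler_sum => i _.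
  by rewrite iter_generated_operator.
by apply: ereal_sup_ubound; exists n.
Qed.

End suprema.

Theorem theorem2p4 (R : realType) (X : completeNormedModType R)
    (hX : reflexive_space X)
    (d : measure_display) (Omega : measurableType d)
    (mu : {finite_measure set Omega -> \bar R})
    (tau : Omega -> Omega) (htau : endomorphism mu tau)
    (F : nat -> set (set Omega)) (Foo : set (set Omega))
    (hF : forall n : nat, sub_sigma_algebra_of (F n))
    (hFoo : decreasing_to F Foo)
    (f : Omega -> X)
    (hsup : mu.-integrable setT
       (sup_norm (fun n : nat => ergodic_average tau n.+1 f)))
    (g : nat -> nat -> Omega -> X)
    (hg : forall n1 n2 : nat,
       is_condexp mu (F n2) (ergodic_average tau n1.+1 f) (g n1 n2)) :
  (forall p : R, 1 < p -> Lp_space mu p f ->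
     ('N[mu]_(p%:E)[sup_norm (fun n : nat * nat => g n.1 n.2)]
        <= ((p / (p - 1)) ^+ 2)%:E * 'N[mu]_(p%:E)[(fun w => `|f w|%:E)])%E) /\
  (forall m : nat, LlogL_space mu m.+2 f ->
     LlogL_ereal mu m (sup_norm (fun n : nat * nat => g n.1 n.2))).
Proof.
set G := sup_norm (fun n : nat * nat => g n.1 n.2).
set M := sup_norm (fun n : nat => ergodic_average tau n.+1 f) in hsup.
pose h w := `|f w|.
pose H w := ereal_sup (range
  (fun n => (n.+1%:R^-1 * \sum_(i < n.+1) h (iter i tau w))%:E)).
have mG : measurable_fun setT G.
  apply: measurable_sup_norm => -[n1 n2] /=.
  have [[s ss sg] _ _] := hg n1 n2.
  exists s => // n; have [fs Fs] := ss n; split=> // x.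
  exact: (hF n2).2.
have G0 w : (0 <= G w)%E by exact: sup_norm_ge0.
have mM : measurable_fun setT M by exact: measurable_int hsup.
have M0 w : (0 <= M w)%E by exact: sup_norm_ge0.
have iM : (\int[mu]_w M w < +oo)%E.
  have /integrableP[_] := hsup.
  by under eq_integral do rewrite gee0_abs//.
have GM : weak_type mu G M.
  apply: (condexp_weak_type hFoo.1 hF hg) => // i w.
  by apply: ereal_sup_ubound; exists i.
have MH w : (M w <= H w)%E by exact: sup_norm_ergodic_average_le.
have H0 w : (0 <= H w)%E by exact: le_trans (MH w).
have h0 w : 0 <= h w by exact: normr_ge0.
have strong (sf : strongly_measurable measurable f) :
    [/\ measurable_fun setT h, measurable_fun setT H,
        mu.-integrable setT (EFin \o h) & weak_type mu H (EFin \o h)].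
  have mh : measurable_fun setT h.
    have := strongly_measurable_norm 0 sf => /measurable_EFinP.
    by under eq_fun do rewrite subr0.
  have miter k : measurable_fun setT (iter k tau).
    elim: k => [|k IH]; first exact: measurable_id.
    exact: (measurableT_comp htau.1 IH).
  have mH : measurable_fun setT H.
    apply: measurable_ereal_sup => n; apply/measurable_EFinP.
    apply: measurable_funM => //; apply: measurable_sum => i.
    exact: measurableT_comp.
  have ih : (\int[mu]_w (h w)%:E < +oo)%E.
    apply: le_lt_trans iM; apply: ge0_le_integral => //.
    - by move=> w _; rewrite lee_fin.
    - exact/measurable_EFinP.
    - move=> w _; apply: ereal_sup_ubound; exists 0%N => //.
      by rewrite /ergodic_average big_ord1/= invr1 scale1r.
  split=> //; last exact: (maximal_ergodic htau).
  apply/integrableP; split; first exact/measurable_EFinP.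
  by under eq_integral do rewrite /= ger0_norm//.
split=> [p p1 [sf _]|m [sf wf]].
  have [mh mH ih Hh] := strong sf.
  have p0 : 0 < p by exact: lt_trans p1.
  have q0 : 0 <= p / (p - 1) by rewrite divr_ge0 ?subr_ge0 ?(ltW p0) ?(ltW p1).
  apply: le_trans (weak_type_Lnorm p1 mG G0 hsup M0 GM) _.
  rewrite [in leRHS]expr2 [in leRHS]EFinM -[leRHS]muleA.
  apply: lee_wpmul2l; first by rewrite lee_fin.
  apply: le_trans (weak_type_Lnorm p1 mH H0 ih _ Hh) => //.
  by apply: Lnorm_le => // w; rewrite M0 MH.
have [mh mH ih Hh] := strong sf.
split=> //; under eq_integral do rewrite gee0_abs//.
apply: (weak_type_LlogL mG G0 mM M0 GM iM).
apply: (@le_lt_trans _ _ (\int[mu]_w LlogL_weight m.+1 (H w))%E).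
  apply: ge0_le_integral => //.
  - by move=> w _; exact: LlogL_weight_ge0.
  - exact: measurable_LlogL_weight.
  - exact: measurable_LlogL_weight.
  - by move=> w _; exact: LlogL_weight_le.
apply: (weak_type_LlogL mH H0 _ _ Hh) => //; first exact/measurable_EFinP.
have /integrableP[_] := ih.
by under eq_integral do rewrite /= ger0_norm//.
Qed.
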